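(* Let $C$ be a nonempty convex weakly compact subset of a Banach space $X$ with $M(X)>1$. Then every mapping $T:C\to C$ which satisfies condition $(C)$, and every continuous mapping $T:C\to C$ which satisfies condition $(C_\lambda)$ for some $\lambda\in(0,1)$, has a fixed point.
   Context: For $\lambda\in(0,1)$, a mapping $T:C\to X$ satisfies condition $(C_\lambda)$ if for all $x,y\in C$: $\lambda\|x-Tx\|\le\|x-y\|$ implies $\|Tx-Ty\|\le\|x-y\|$. Condition $(C)$ is condition $(C_{1/2})$. For $a\ge 0$, $$R(a,X)=\sup\Big\{\liminf_{n\to\infty}\|y_n+x\|\Big\},$$ where the supremum is taken over all $x\in X$ with $\|x\|\le a$ and all weakly null sequences $(y_n)$ in the closed unit ball $B_X$ such that $\limsup_{n\to\infty}\limsup_{m\to\infty}\|y_n-y_m\|\le 1$. Furthermore $$M(X)=\sup\Big\{\frac{1+a}{R(a,X)} : a\ge 0\Big\}\in[0,\infty],$$ with a quotient whose denominator is $0$ read as $+\infty$. *)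

(* Defs.v *)
From HB Require Import structures.
From mathcomp Require Import all_boot all_order all_algebra.
From mathcomp Require Import all_classical all_reals all_analysis.

Set Implicit Arguments.
Unset Strict Implicit.
Unset Printing Implicit Defensive.

Import Order.TTheory GRing.Theory Num.Theory.
Import numFieldNormedType.Exports.

Local Open Scope classical_set_scope.
Local Open Scope ring_scope.

Definition top_dual (R : realType) (X : normedModType R) : Type :=
  {f : {scalar X} | continuous (f : X -> R)}.

(* X with the coarsest topology making every element of its topological dual
   continuous. *)
Definition weak (R : realType) (X : normedModType R) : Type :=
  sup_topology (fun f : top_dual X =>
    Topological.class (initial_topology (sval f : X -> R))).

HB.instance Definition _ (R : realType) (X : normedModType R) :=
  Topological.copy (weak X) (sup_topology _).

Definition weakly_null (R : realType) (X : normedModType R) (y : nat -> X) :=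
  (y : nat -> weak X) @ \oo --> ((0 : X) : weak X).

Definition weakly_compact (R : realType) (X : normedModType R) (C : set X) :=
  compact (C : set (weak X)).

(* Limits superior and inferior, and suprema, are taken in the extended reals,
   where they always exist; the supremum below lies in [0, 1 + a] for
   a >= 0. *)
Definition param_R (R : realType) (X : normedModType R) (a : R) : \bar R :=
  ereal_sup [set r : \bar R | exists (x : X) (y : nat -> X),
    [/\ `|x| <= a,
        forall n, `|y n| <= 1,
        weakly_null y,
        (limn_esup (fun n => limn_esup (fun m => `|y n - y m|%:E)) <= 1)%E
      & r = limn_einf (fun n => `|y n + x|%:E)]].

(* In [\bar R], [0^-1 = +oo], so a quotient with zero denominator is [+oo]. *)
Definition param_M (R : realType) (X : normedModType R) : \bar R :=
  ereal_sup [set ((1 + a)%:E / param_R X a)%E | a in [set a : R | 0 <= a]].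

Definition condC_ (R : realType) (X : normedModType R) (lambda : R)
    (C : set X) (T : X -> X) :=
  forall x y, C x -> C y ->
    lambda * `|x - T x| <= `|x - y| -> `|T x - T y| <= `|x - y|.

Definition condC (R : realType) (X : normedModType R) (C : set X)
    (T : X -> X) := condC_ 2^-1 C T.

(* Main.v *)
Require Import Defs.
From HB Require Import structures.
From mathcomp Require Import all_boot all_order all_algebra.
From mathcomp Require Import all_classical all_reals all_analysis.
From mathcomp Require Import ring lra.

Set Implicit Arguments.
Unset Strict Implicit.
Unset Printing Implicit Defensive.

Import Order.TTheory GRing.Theory Num.Theory.
Import numFieldNormedType.Exports.

Local Open Scope classical_set_scope.
Local Open Scope ring_scope.

(** The argument runs by contradiction on a minimal set.  Write
    [d(x) = |x - T x|]; points with small [d] are approximate fixed points.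

    Weak compactness and Zorn's lemma give a nonempty closed convex subset [K]
    of [C], invariant under [T] and minimal as such.  Suppose [T] has no fixed
    point in [K].  Either hypothesis on [T] then makes approximate fixed points
    approach [T x] asymptotically no worse than they approach [x]
    ([condC_afp_stable], [continuous_afp_stable]).  So the sublevel sets of
    [x |-> limsup |u_n - x|], for a sequence [u] of approximate fixed points,
    are invariant, and minimality makes this function constant on [K]
    ([asymptotic_radius_constant], in the manner of Goebel and Karlovitz).  Let
    [c > 0] be the least constant so obtained.  It is attained by a sequence
    [u], and approximate fixed points cannot lie much closer than [c] to any
    given point of [K] ([minimal_afp_sequence]).

    The contradiction comes from approximate fixed points that are too close to
    the weak limit [v] of (a subsequence of) [u].  As [M(X) > 1], there are
    [a > 0] and [r < 1 + a] with [R(a, X) <= r]; by convexity [a] may be taken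
    at most [1/3] ([M_gt1_R_witness]).  Put [t = 1/(1 + a)], fix one very good
    approximate fixed point [p] at distance about [c] from all the [u_n], and
    apply the averaged map [S = l T + (1 - l) id] repeatedly to the points
    [t u_n + (1 - t) p].  The iterates keep, up to a small error, distance at
    most [(1 - t) c] to [u_n], at most [t c] to [p], and at most [t c] to each
    other ([krasnoselskii_between]).  The subtle point is that condition
    [(C_l)] only speaks about pairs that are far apart in comparison with their
    displacement; the three estimates, together with the lower bounds by [c],
    put every pair that is used in this situation, thanks to [a <= 1/3].
    A number of steps that does not depend on the starting point turns the
    iterates [z_n] into approximate fixed points
    ([uniform_asymptotic_regularity], from the Goebel-Kirk inequality).  If [w]
    is the weak limit of (a subsequence of) [z_n], then
    [z_n = (z_n - w) + (w - v) + v], where [(z_n - w)/(t c)] is an admissible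
    sequence in the definition of [R(a, X)] and [|w - v|/(t c) <= a]; hence some
    [z_n] is within about [r t c < c] of [v], against the choice of [c].

    The functional analysis rests on one form of the Hahn-Banach theorem: a
    convex 1-Lipschitz function has a subgradient at every point
    ([subgradient]).  Applied to the norm and to the distance to a convex set,
    it yields norming functionals and the weak closedness of closed convex
    sets, hence the sequential half of the Eberlein-Smulian theorem
    ([weakly_compact_subsequence]) and, with a gliding hump, the boundedness
    of weakly compact sets ([weakly_compact_bounded]). *)

(** * Linear minorants of convex functions *)

Lemma Zorn_in (T : Type) (P : set T) (R : T -> T -> Prop) :
    (forall t, R t t) -> (forall r s t, R r s -> R s t -> R r t) ->
    (forall s t, R s t -> R t s -> s = t) ->
    (forall F : set T, F `<=` P -> total_on F R ->
       exists2 b, P b & forall s, F s -> R s b) ->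
  exists2 m, P m & forall s, P s -> R m s -> s = m.
Proof.
move=> Rxx Rtr Ranti Rub; pose r (s t : {x | P x}) := `[< R (sval s) (sval t) >].
have [| | |A totA|[m Pm] mmax] := @Zorn _ r.
- by move=> s; exact/asboolP.
- by move=> s t u /asboolP st /asboolP tu; apply/asboolP; exact: Rtr st tu.
- move=> [s Ps] [t Pt] /asboolP /= st /asboolP /= ts.
  exact/eq_exist/Ranti.
- have [|_ _ [u Au <-] [v Av <-]|b Pb Ab] := Rub (sval @` A).
  + by move=> _ [[s Ps] _ <-].
  + by have [/asboolP|/asboolP] := totA _ _ Au Av; [left|right].
  + by exists (exist _ b Pb) => s As; apply/asboolP; apply: Ab; exists s.
exists m => // s Ps ms.
by have /(_ _)/(congr1 sval) := mmax (exist _ s Ps); apply; exact/asboolP.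
Qed.

(** Weights are plain scalars so that inequalities between values of [g] can be
    fed to linear arithmetic. *)
Definition convexf (R : realType) (X : lmodType R) (g : X -> R) :=
  forall x y s, 0 <= s -> s <= 1 ->
    g (s *: x + (1 - s) *: y) <= s * g x + (1 - s) * g y.

Section LinearMinorant.
Variables (R : realType) (X : lmodType R).

Let cminorant (g : X -> R) : set (X -> R) :=
  [set h | [/\ convexf h, forall x, h x <= g x & 0 <= h 0]].

(* Evaluating at [x] and [-x] shows that minorants are bounded below, so a
   chain of them has a pointwise infimum. *)
Let minorant_lb (g h : X -> R) x : cminorant g h -> - g (- x) <= h x.
Proof.
move=> [hcv hg h0]; have := hcv x (- x) 2^-1 ltac:(lra) ltac:(lra).
have -> : 2^-1 *: x + (1 - 2^-1) *: - x = 0.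
  by rewrite scalerN -scalerBl [_ - (1 - _)](_ : _ = 0) ?scale0r//; lra.
have := hg (- x); lra.
Qed.

Let min_minorant (g : X -> R) : convexf g -> 0 <= g 0 ->
  exists2 h, cminorant g h & forall k, cminorant g k ->
    (forall x, k x <= h x) -> k = h.
Proof.
move=> gcv g0.
apply: (Zorn_in (R := fun h k : X -> R => forall x, k x <= h x)) => //.
- by move=> r s t rs st x; exact: le_trans (st x) (rs x).
- by move=> s t st ts; apply/funext => x; apply/eqP; rewrite eq_le st ts.
move=> F FP totF; have [[h0 Fh0]|/set0P/negP/negPn/eqP F0] :=
  pselect (F !=set0); last by exists g => [|s]; [split|rewrite F0].
pose b x := inf [set h x | h in F].
have has_infF x : has_inf [set h x | h in F].
  split; first by exists (h0 x), h0.
  by exists (- g (- x)) => _ [h Fh <-]; exact/minorant_lb/FP.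
have bF h x : F h -> b x <= h x.
  by move=> Fh; apply: ge_inf; [exact: (has_infF x).2|exists h].
exists b => //; last by move=> s Fs x; exact: bF.
split.
- move=> x y s s0 s1; apply/ler_addgt0Pr => e e0.
  have [_ [h1 Fh1 <-] h1x] := inf_adherent e0 (has_infF x).
  have [_ [h2 Fh2 <-] h2x] := inf_adherent e0 (has_infF y).
  have [h Fh [hh1 hh2]] : exists2 h, F h & h x <= h1 x /\ h y <= h2 y.
    have [h12|h21] := totF _ _ Fh1 Fh2; first by exists h2 => //; split.
    by exists h1 => //; split.
  apply: (le_trans (bF h _ Fh)); have [hcv _ _] := FP _ Fh.
  apply: (le_trans (hcv x y s s0 s1)).
  move: h1x h2x; rewrite -/(b x) -/(b y); nra.
- by move=> x; have [_ h0g _] := FP _ Fh0; exact: le_trans (bF _ x Fh0) (h0g x).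
- apply: lb_le_inf; first exact: (has_infF 0).1.
  by move=> _ [h /FP[_ _ h00] <-].
Qed.

(** A minimal convex minorant [h] with [h 0 >= 0] is linear.  By convexity,
    [x |-> h (s x) / s] and [x |-> 2 h ((x + y) / 2) - h y] lie below [h]; once
    they are known to be minorants of the same kind, minimality turns them into
    [h] itself, which is homogeneity and additivity. *)
Lemma linear_minorant (g : X -> R) : convexf g -> 0 <= g 0 ->
  exists f : {scalar X}, forall x, f x <= g x.
Proof.
move=> gcv g0; have [h hP hmin] := min_minorant gcv g0.
have [hcv hg h00] := hP.
have h0 : h 0 = 0.
  have kP : cminorant g (fun x => h x - h 0).
    split=> [x y s s0 s1|x|]; [have := hcv x y s s0 s1| |]; last by lra.
    - by lra.
    - by have := hg x; lra.
  have kh x : h x - h 0 <= h x by lra.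
  by have /(congr1 (@^~ 0)) := hmin _ kP kh; rewrite /= subrr.
have hZ01 s x : 0 < s -> s <= 1 -> h (s *: x) = s * h x.
  move=> s0 s1; have kh y : s^-1 * h (s *: y) <= h y.
    have := hcv y 0 s (ltW s0) s1; rewrite scaler0 addr0 h0 mulr0 addr0 => H.
    by rewrite -(ler_pM2l s0) mulrA divff ?gt_eqF// mul1r.
  have kP : cminorant g (fun x => s^-1 * h (s *: x)).
    split=> [y z r r0 r1|y|]; last by rewrite scaler0 h0 mulr0.
    - have := hcv (s *: y) (s *: z) r r0 r1.
      rewrite !scalerA ![_ * s]mulrC -!scalerA -scalerDr => H.
      rewrite -(ler_pM2l s0) mulrDr !mulrA divff ?gt_eqF//.
      rewrite [s * r]mulrC [s * (1 - r)]mulrC -!mulrA ![s * (_ * _)]mulrA.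
      by rewrite divff ?gt_eqF// !mul1r.
    - exact: le_trans (kh y) (hg y).
  have /(congr1 (@^~ x)) /= <- := hmin _ kP kh.
  by rewrite mulrA divff ?gt_eqF// mul1r.
have hhalf x y : h (2^-1 *: x + 2^-1 *: y) = 2^-1 * h x + 2^-1 * h y.
  have half : 1 - 2^-1 = 2^-1 :> R by lra.
  pose k x := 2 * (h (2^-1 *: x + 2^-1 *: y) - 2^-1 * h y).
  have kh z : k z <= h z.
    by have := hcv z y 2^-1 ltac:(lra) ltac:(lra); rewrite /k half; lra.
  have kP : cminorant g k.
    split=> [u v r r0 r1|u|]; last first.
    - by rewrite /k scaler0 add0r hZ01; lra.
    - exact: le_trans (kh u) (hg u).
    have := hcv (2^-1 *: u + 2^-1 *: y) (2^-1 *: v + 2^-1 *: y) r r0 r1.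
    rewrite (_ : r *: _ + _ =
      2^-1 *: (r *: u + (1 - r) *: v) + 2^-1 *: y); first by rewrite /k; lra.
    rewrite !scalerDr !scalerA addrACA -scalerDl.
    by congr (_ *: _ + _ *: _ + _ *: _); lra.
  by have /(congr1 (@^~ x)) := hmin _ kP kh; rewrite /k; lra.
have hD x y : h (x + y) = h x + h y.
  have := hhalf x y; rewrite -scalerDr hZ01; lra.
have hN x : h (- x) = - h x.
  by have := hD x (- x); rewrite subrr h0; lra.
have hZn n x : h (n%:R *: x) = n%:R * h x.
  elim: n => [|n IH]; first by rewrite scale0r mul0r.
  by rewrite -natr1 scalerDl hD IH scale1r mulrDl mul1r.
have hZp s x : 0 < s -> h (s *: x) = s * h x.
  move=> s0; pose n := (Num.truncn s).+1.
  have n0 : 0 < n%:R :> R by rewrite ltr0n.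
  have -> : s *: x = n%:R *: ((s / n%:R) *: x).
    by rewrite scalerA mulrCA divff ?gt_eqF// mulr1.
  rewrite hZn hZ01 ?divr_gt0//; last first.
    by rewrite ler_pdivrMr// mul1r ltW// truncnS_gt.
  by rewrite mulrA mulrCA divff ?gt_eqF// mulr1.
have hZ s x : h (s *: x) = s * h x.
  have [s0|s0|<-] := ltgtP 0 s; last by rewrite scale0r mul0r.
  - exact: hZp.
  - rewrite -[s]opprK scaleNr hN hZp ?oppr_gt0//; ring.
have hlin : scalar h by move=> s x y; rewrite hD hZ.
pose f : {scalar X} := HB.pack h (GRing.isLinear.Build _ _ _ _ _ hlin).
by exists f.
Qed.

End LinearMinorant.

(** * Subgradients and the weak topology *)

Section WeakTopology.
Variables (R : realType) (X : normedModType R).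
Implicit Types (f : top_dual X) (A : set X).

(** A linear minorant of [v |-> g (x0 + v) - g x0]; the Lipschitz bound makes
    it continuous. *)
Lemma subgradient (g : X -> R) x0 : convexf g ->
    (forall x y, g x - g y <= `|x - y|) ->
  exists f, (forall v, `|sval f v| <= `|v|) /\
    (forall x, sval f (x - x0) <= g x - g x0).
Proof.
move=> gcv gL; pose g0 v := g (v + x0) - g x0.
have g0cv : convexf g0.
  move=> x y s s0 s1; rewrite /g0.
  have := gcv (x + x0) (y + x0) s s0 s1.
  rewrite [_ *: _ + _](_ : _ = s *: x + (1 - s) *: y + x0); first by lra.
  by rewrite !scalerDr addrACA -scalerDl [s + _]addrC subrK scale1r.
have [|f fg0] := linear_minorant g0cv; first by rewrite /g0 add0r subrr.
have fv v : f v <= `|v|.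
  by apply: le_trans (fg0 v) _; rewrite -[in leRHS](addrK x0 v) gL.
have fb v : `|f v| <= `|v|.
  by rewrite ler_norml fv andbT lerNl -raddfN -normrN fv.
have fc : continuous (f : X -> R).
  move=> x; apply/cvgrPdist_le => e e0; near=> y.
  rewrite -raddfB; apply: le_trans (fb _) _.
  by near: y; apply: cvgr_dist_le.
exists (exist _ f fc); split => //= x.
by apply: le_trans (fg0 _) _; rewrite /g0 subrK.
Unshelve. all: by end_near. Qed.

Lemma norming_functional x : exists f,
  (forall v, `|sval f v| <= `|v|) /\ sval f x = `|x|.
Proof.
have [||f [fb fx]] := @subgradient (fun u : X => `|u|) x.
- move=> u v s s0 s1; apply: le_trans (ler_normD _ _) _.
  by rewrite !normrZ !ger0_norm// subr_ge0.
- by move=> u v; exact: lerB_dist.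
exists f; split=> //; apply/eqP; rewrite eq_le.
have := fx 0; rewrite sub0r raddfN normr0.
have := fb x; have := ler_norm (sval f x); move=> ? ? ?.
by apply/andP; split; lra.
Qed.

Lemma convex_setP A : convex_set A <-> forall x y s, 0 <= s -> s <= 1 ->
  A x -> A y -> A (s *: x + (1 - s) *: y).
Proof.
split=> [/convex_setW Acv x y s s0 s1 Ax Ay|Acv].
  move: s0 s1; rewrite le_eqVlt => /predU1P[<-|s0].
    by rewrite scale0r add0r subr0 scale1r.
  rewrite le_eqVlt => /predU1P[->|s1].
    by rewrite subrr scale0r addr0 scale1r.
  have := Acv x y (mem_set Ax) (mem_set Ay) (Itv01 (ltW s0) (ltW s1)) s0 s1.
  by move=> /set_mem.
apply/convex_setW => x y /set_mem Ax /set_mem Ay l l0 l1; apply/mem_set.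
by apply: Acv => //; exact/ltW.
Qed.

Definition dist_to A x : R := inf [set `|x - a| | a in A].

Lemma dist_to_has_inf A x : A !=set0 -> has_inf [set `|x - a| | a in A].
Proof. by case=> a Aa; split; [exists `|x - a|, a|exists 0 => _ [b _ <-]]. Qed.

Lemma dist_to_le A x a : A a -> dist_to A x <= `|x - a|.
Proof.
move=> Aa; apply: ge_inf; last by exists a.
by apply: (dist_to_has_inf x _).2; exists a.
Qed.

Lemma dist_to_adherent A x e : A !=set0 -> 0 < e ->
  exists2 a, A a & `|x - a| < dist_to A x + e.
Proof.
by move=> A0 /inf_adherent/(_ (dist_to_has_inf x A0))[_ [a Aa <-]]; exists a.
Qed.

Lemma dist_to_lipschitz A x y : A !=set0 -> dist_to A x - dist_to A y <= `|x - y|.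
Proof.
move=> A0; apply/ler_addgt0Pr => e e0; have [a Aa ya] := dist_to_adherent y A0 e0.
have := dist_to_le x Aa; have := ler_distD y x a; lra.
Qed.

Lemma dist_to_convex A : A !=set0 -> convex_set A -> convexf (dist_to A).
Proof.
move=> A0 /convex_setP Acv x y s s0 s1; apply/ler_addgt0Pr => e e0.
have [a Aa xa] := dist_to_adherent x A0 e0.
have [b Ab yb] := dist_to_adherent y A0 e0.
apply: le_trans (dist_to_le _ (Acv a b s s0 s1 Aa Ab)) _.
rewrite opprD addrACA -!scalerBr; apply: le_trans (ler_normD _ _) _.
rewrite !normrZ !ger0_norm ?subr_ge0//; nra.
Qed.

Lemma dist_to_gt0 A x : closed A -> A !=set0 -> ~ A x -> 0 < dist_to A x.
Proof.
move=> Acl A0 nAx; have /nbhs_ballP[e /= e0 eA] : nbhs x (~` A).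
  by apply: open_nbhs_nbhs; split => //; exact: closed_openC.
apply: lt_le_trans e0 _; apply: lb_le_inf; first exact: (dist_to_has_inf x A0).1.
move=> _ [a Aa <-]; rewrite leNgt; apply/negP => xa.
by apply: (eA a) => //; rewrite -ball_normE.
Qed.

(** A subgradient at [x] of the distance to [A] separates, with the distance
    from [x] to [A] as the gap. *)
Lemma convex_separation A x : closed A -> convex_set A -> A !=set0 -> ~ A x ->
  exists f d, 0 < d /\ forall a, A a -> sval f a <= sval f x - d.
Proof.
move=> Acl Acv A0 nAx.
have [|u v|f [_ fx]] := @subgradient (dist_to A) x.
- exact: dist_to_convex.
- exact: dist_to_lipschitz.
exists f, (dist_to A x); split=> [|a Aa]; first exact: dist_to_gt0.
have := fx a; have := dist_to_le a Aa; rewrite subrr normr0 raddfB; lra.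
Qed.

Lemma weak_cvgP (F : set_system (weak X)) (v : weak X) : Filter F ->
  F --> v <-> forall f, sval f x @[x --> F] --> sval f v.
Proof.
move=> FF; rewrite (@cvg_sup X (top_dual X)
  (fun f => Topological.class (initial_topology (sval f : X -> R))) F v FF).
split=> Fv f.
  exact: cvg_trans (cvg_app _ (Fv f))
    (@initial_continuous X R (sval f : X -> R) v).
move=> A /= [_ [[B Bop <-] Bfs sBfA]].
by apply: filterS sBfA _; apply: Fv; exact: open_nbhs_nbhs.
Qed.

Lemma dual_weak_continuous f : continuous (sval f : weak X -> R).
Proof.
by move=> v; move: f; apply/weak_cvgP; [exact: nbhs_filter|exact: cvg_id].
Qed.

(** Weak convergence of a sequence, tested on functionals; [weak_cvgP] relates
    it to the topology. *)
Definition wcvg (y : nat -> X) (v : X) :=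
  forall f, sval f (y n) @[n --> \oo] --> sval f v.

Lemma weakly_nullP (y : nat -> X) : wcvg y 0 <-> weakly_null y.
Proof. by rewrite /weakly_null weak_cvgP. Qed.

Lemma closed_convex_weakly_closed A : closed A -> convex_set A ->
  closed (A : set (weak X)).
Proof.
move=> Acl Acv; have [A0|/set0P/negP/negPn/eqP ->] := pselect (A !=set0);
  last exact: closed0.
move=> v clv; apply: contrapT => nAv.
have [f [d [d0 fd]]] := convex_separation Acl Acv A0 nAv.
have /clv[a [Aa /=]] : nbhs v [set y : weak X | `|sval f v - sval f y| < d].
  by have /cvgrPdist_lt/(_ d d0) := @dual_weak_continuous f v.
by have := fd _ Aa; move=> /[swap] /ltr_normlW; lra.
Qed.

Lemma wcvgB (y z : nat -> X) v w : wcvg y v -> wcvg z w ->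
  wcvg (fun n => y n - z n) (v - w).
Proof.
move=> yv zw f; rewrite raddfB; under eq_cvg do rewrite raddfB.
exact: cvgB (yv f) (zw f).
Qed.

Lemma wcvgZ (y : nat -> X) v s : wcvg y v -> wcvg (fun n => s *: y n) (s *: v).
Proof.
move=> yv f; rewrite linearZ; under eq_cvg do rewrite linearZ.
exact: cvgM (cvg_cst _) (yv f).
Qed.

Lemma wcvg_cst (v : X) : wcvg (fun=> v) v.
Proof. by move=> f; exact: cvg_cst. Qed.

Lemma wcvg_norm_le (y : nat -> X) v r : wcvg y v ->
  (\forall n \near \oo, `|y n| <= r) -> `|v| <= r.
Proof.
move=> yv yr; have [f [fb <-]] := norming_functional v.
have := yv f; apply: (closed_cvg (fun t : R => t <= r)); first exact: closed_le.
by apply: filterS yr => n; apply: le_trans; apply: le_trans (fb _); exact: ler_norm.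
Qed.

End WeakTopology.

(** * Weak sequential compactness *)

Section EberleinSmulian.
Variables (R : realType) (X : normedModType R).
Implicit Types (f : top_dual X) (x : nat -> X).

Definition rat_comb x (s : seq (rat * nat)) : X :=
  \sum_(p <- s) ratr p.1 *: x p.2.

Lemma rat_dense (r e : R) : 0 < e -> exists q : rat, `|r - ratr q| < e.
Proof.
move=> e0; have [q] := @rat_in_itvoo R (r - e) (r + e) ltac:(lra).
by rewrite in_itv /= => ?; exists q; rewrite distrC ltr_distl.
Qed.

(** The closed linear span of the sequence.  Rational combinations are used
    because there are only countably many of them. *)
Definition closed_span x : set X :=
  [set v | forall e, 0 < e -> exists s, `|v - rat_comb x s| < e].

Lemma closed_span_mem x n : closed_span x (x n).
Proof.
move=> e e0; exists [:: (1, n)].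
by rewrite /rat_comb big_seq1 rmorph1 scale1r subrr normr0.
Qed.

Lemma closed_spanD x u v : closed_span x u -> closed_span x v ->
  closed_span x (u + v).
Proof.
move=> xu xv e e0.
have [s us] := xu (e / 2) ltac:(lra); have [t vt] := xv (e / 2) ltac:(lra).
exists (s ++ t); rewrite /rat_comb big_cat opprD addrACA.
apply: le_lt_trans (ler_normD _ _) _; rewrite -!/(rat_comb _ _).
move: us vt; rewrite /rat_comb; lra.
Qed.

Lemma closed_spanZ x r u : closed_span x u -> closed_span x (r *: u).
Proof.
move=> xu e e0; have r0 : 0 < `|r| + 1 by have := normr_ge0 r; lra.
have [s us] := xu (e / 2 / (`|r| + 1)) ltac:(by rewrite !divr_gt0).
have d0 : 0 < `|rat_comb x s| + 1 by have := normr_ge0 (rat_comb x s); lra.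
have [q rq] := @rat_dense r (e / 2 / (`|rat_comb x s| + 1))
  ltac:(by rewrite !divr_gt0).
exists [seq (q * p.1, p.2) | p <- s].
have -> : rat_comb x [seq (q * p.1, p.2) | p <- s] = ratr q *: rat_comb x s.
  rewrite /rat_comb big_map scaler_sumr; apply: eq_bigr => p _ /=.
  by rewrite rmorphM scalerA.
rewrite [r *: u - _](_ : _ =
  r *: (u - rat_comb x s) + (r - ratr q) *: rat_comb x s); last first.
  by rewrite scalerBr scalerBl addrA subrK.
apply: le_lt_trans (ler_normD _ _) _; rewrite !normrZ.
move: us rq; rewrite !ltr_pdivlMr// => us rq.
have := normr_ge0 (u - rat_comb x s); have := normr_ge0 (r - ratr q).
nra.
Qed.

Lemma closed_span_closed x : closed (closed_span x).
Proof.
move=> v clv e e0.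
have [w [xw /=]] := clv _ (nbhsx_ballx v (e / 2) ltac:(lra)).
rewrite -ball_normE /= => vw; have [s ws] := xw (e / 2) ltac:(lra).
exists s; have := ler_distD w v (rat_comb x s); lra.
Qed.

Lemma closed_span_convex x : convex_set (closed_span x).
Proof.
apply/convex_setP => u v s _ _ xu xv.
by apply: closed_spanD; exact: closed_spanZ.
Qed.

(** Norming functionals of the countably many rational combinations suffice: a
    nonzero vector of the span is close to such a combination, whose norming
    functional does not vanish on it. *)
Lemma closed_span_separating x : exists F : nat -> top_dual X,
  forall v w, closed_span x v -> closed_span x w ->
    (forall j, sval (F j) v = sval (F j) w) -> v = w.
Proof.
have [N hN] := choice (fun d : X => norming_functional d).
exists (fun j => N (rat_comb x (odflt [::] (unpickle j)))) => v w xv xw Fvw.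
apply/eqP; rewrite -subr_eq0 -normr_eq0; apply/eqP/le_anti/andP; split => //.
apply/ler_addgt0Pr => e e0; rewrite add0r.
have [||s vs] := (_ : closed_span x (v - w)) (e / 2).
- by rewrite -scaleN1r; apply: closed_spanD => //; exact: closed_spanZ.
- lra.
have [Nb Ns] := hN (rat_comb x s).
have := Fvw (pickle s); rewrite pickleK /= => Evw.
have := Nb (v - w - rat_comb x s); rewrite !linearB Evw subrr sub0r normrN Ns.
rewrite ger0_norm//; have := ler_distD (rat_comb x s) (v - w) 0.
by rewrite !subr0; lra.
Qed.

Lemma weakly_compact_cluster C x : weakly_compact C -> (forall n, C (x n)) ->
  exists2 v, C v & forall (B : set (weak X)) N, nbhs (v : weak X) B ->
    exists2 n, (N <= n)%N & B (x n).
Proof.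
move=> Cco Cx; have [|v [Cv clv]] := Cco (x @ \oo) _ _.
  by exists 0%N => // n _; exact: Cx.
exists v => // B N vB; have [_ [[n Nn <-] Bn]] :=
    clv [set x n | n in [set n | (N <= n)%N]] B
        (ex_intro2 _ _ N I (fun n Nn => ex_intro2 _ _ n Nn erefl)) vB.
by exists n.
Qed.

Lemma closed_span_cluster x y v : (forall n, closed_span x (y n)) ->
  (forall (B : set (weak X)) N, nbhs (v : weak X) B ->
    exists2 n, (N <= n)%N & B (y n)) -> closed_span x v.
Proof.
move=> xy clv; apply: (closed_convex_weakly_closed (@closed_span_closed x)).
  exact: closed_span_convex.
by move=> B /(clv _ 0%N)[n _ Bn]; exists (y n).
Qed.

Lemma dual_nbhs f (v : weak X) e : 0 < e ->
  nbhs v [set w : weak X | `|sval f v - sval f w| < e].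
Proof.
by move=> e0; have /cvgrPdist_lt/(_ e e0) := @dual_weak_continuous _ _ f v.
Qed.

Lemma dual_nbhs_le (F : nat -> top_dual X) (v : weak X) e k : 0 < e ->
  nbhs v [set w : weak X | forall j, (j <= k)%N ->
    `|sval (F j) v - sval (F j) w| < e].
Proof.
move=> e0; elim: k => [|k IH].
  by apply: filterS (dual_nbhs (F 0%N) v e0) => w ? j; rewrite leqn0 => /eqP->.
apply: filterS2 IH (dual_nbhs (F k.+1) v e0) => w wk wk1 j.
by rewrite leq_eqVlt ltnS => /predU1P[->//|]; exact: wk.
Qed.

(** Let [v] be a weak cluster point of [x].  Choose the subsequence so that
    each functional of a countable family separating the closed span of [x]
    converges to its value at [v].  Any weak cluster point of a further
    subsequence lies in this span and agrees with [v] on the family, so equals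
    [v]; by compactness the subsequence converges weakly to [v]. *)
Theorem weakly_compact_subsequence C x : weakly_compact C ->
    (forall n, C (x n)) ->
  exists phi v, [/\ increasing_seq phi, C v & wcvg (x \o phi) v].
Proof.
move=> Cco Cx; have [F Fsep] := closed_span_separating x.
have [v Cv clv] := weakly_compact_cluster Cco Cx.
have xv : closed_span x v.
  by apply: closed_span_cluster clv; exact: closed_span_mem.
have /choice[g hg] : forall p : nat * nat, exists n, (p.2 <= n)%N /\
    forall j, (j <= p.1)%N -> `|sval (F j) v - sval (F j) (x n)| < p.1.+1%:R^-1.
  move=> [k N] /=; have k0 : 0 < k.+1%:R^-1 :> R by [].
  by have [n Nn xn] := clv _ N (dual_nbhs_le F v k k0); exists n.
pose phi := fix phi k := if k is k'.+1 then g (k, (phi k').+1) else g (0, 0)%N.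
have phiF k j : (j <= k)%N ->
    `|sval (F j) v - sval (F j) (x (phi k))| < k.+1%:R^-1.
  by case: k => [|k] jk; [apply: (hg (0, 0)%N).2|apply: (hg (k.+1, _)).2].
exists phi, v; split => //.
  by apply/increasing_seqP => k; exact: (hg (k.+1, (phi k).+1)).1.
move=> f; apply/cvgrPdist_lt => e e0; apply: contrapT => nf.
have /choice[psi hpsi] : forall N, exists n, (N <= n)%N /\
    ~ `|sval f v - sval f (x (phi n))| < e.
  move=> N; apply: contrapT => nN; apply: nf; exists N => // n Nn.
  by apply: contrapT => nn; apply: nN; exists n.
have [w Cw clw] := weakly_compact_cluster Cco (fun n => Cx (phi (psi n))).
have xw : closed_span x w.
  by apply: closed_span_cluster clw => n; exact: closed_span_mem.
have wv : w = v.
  apply: Fsep => // j; apply/eqP/negPn/negP; rewrite -subr_eq0 -normr_gt0 => d0.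
  set d := `|_ - _| in d0; have d20 : 0 < d / 2 by rewrite divr_gt0.
  have [N _ hN] := near_infty_natSinv_lt (PosNum d20).
  have [n Nn /=] := clw _ (maxn j N) (dual_nbhs (F j) w d20).
  rewrite geq_max in Nn; case/andP: Nn => jn Nn; have npsi := (hpsi n).1.
  have := phiF (psi n) j (leq_trans jn npsi).
  have : (psi n).+1%:R^-1 < d / 2 by exact: hN (leq_trans Nn npsi).
  have := ler_distD (sval (F j) (x (phi (psi n)))) (sval (F j) w) (sval (F j) v).
  rewrite -/d [`|sval (F j) v - _|]distrC.
  set a := `|sval (F j) w - _|; set b := `|_ - sval (F j) v|.
  by move: (_^-1) => c; lra.
rewrite wv in clw; have [n _ /=] := clw _ 0%N (dual_nbhs f v e0).
exact: (hpsi n).2.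
Qed.

End EberleinSmulian.

(** * Weakly compact sets are bounded *)

Section Boundedness.
Variables (R : realType) (X : normedModType R).
Implicit Types (f : top_dual X).

Lemma dual_bounded_on C f : weakly_compact C ->
  exists M, forall x, C x -> `|sval f x| <= M.
Proof.
move=> Cco; have : compact ((sval f : weak X -> R) @` C).
  apply: (@continuous_compact (weak X) R) => //.
  by apply: continuous_subspaceT => v; exact: dual_weak_continuous.
move=> /compact_bounded[M [Mr hM]]; exists (M + 1) => x Cx.
by apply: (hM (M + 1)); [rewrite ltrDl|exists x].
Qed.

Lemma geometric_small (p e : R) : 0 <= p -> p < 1 -> 0 < e ->
  exists k, p ^+ k < e.
Proof.
move=> p0 p1 e0; have := @cvg_expr _ p ltac:(by rewrite ger0_norm).
move=> /cvgrPdist_lt/(_ e e0)[k _ /(_ k (leqnn k))] /=; rewrite sub0r normrN.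
by rewrite ger0_norm ?exprn_ge0//; exists k.
Qed.

(** The series [sum_k (F (k+1) - F k)] converges to a continuous functional.
    The limit is taken as the supremum of the lower estimates [F k x - c k x],
    which increase while the upper estimates [F k x + c k x] decrease; the
    explicit rate is what the gliding hump needs. *)
Lemma dual_limit (F : nat -> {scalar X}) : (forall x, F 0 x = 0) ->
    (forall k x, `|F k.+1 x - F k x| <= 3^-1 ^+ k * `|x|) ->
  exists f, forall k x, `|sval f x - F k x| <= 3 / 2 * 3^-1 ^+ k * `|x|.
Proof.
move=> F0 FS; pose c k (x : X) : R := 3 / 2 * 3^-1 ^+ k * `|x|.
pose u x k := F k x - c k x; pose v x k := F k x + c k x.
have cge0 k x : 0 <= c k x by rewrite /c !mulr_ge0// exprn_ge0.
have cS k x : c k x = 3^-1 ^+ k * `|x| + c k.+1 x.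
  by rewrite /c exprS; field.
have uS x k : u x k <= u x k.+1.
  have := FS k x; rewrite ler_norml /u cS => /andP[]; lra.
have vS x k : v x k.+1 <= v x k.
  have := FS k x; rewrite ler_norml /v (cS k) => /andP[]; lra.
have uh x : {homo u x : m n / (m <= n)%N >-> m <= n}.
  exact/(homo_leq lexx le_trans).
have vh x : {homo v x : m n / (m <= n)%N >-> n <= m}.
  by apply: (homo_leq (r := fun m n => n <= m)) => // a b d /[swap]; exact: le_trans.
have uv x k l : u x k <= v x l.
  apply: le_trans (uh x k (maxn k l) (leq_maxl _ _)) _.
  apply: le_trans (vh x l (maxn k l) (leq_maxr _ _)).
  by rewrite /u /v; have := cge0 (maxn k l) x; lra.
pose f x := sup (range (u x)).
have fF k x : `|f x - F k x| <= c k x.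
  have : u x k <= f x.
    apply: ub_le_sup; last by exists k.
    by exists (v x 0) => _ [l _ <-].
  have : f x <= v x k.
    by apply: ge_sup; [exists (u x 0), 0%N|move=> _ [l _ <-]].
  by rewrite /u /v ler_norml; move=> ? ?; apply/andP; split; lra.
have flin : scalar f.
  move=> a x y; apply/eqP; rewrite -subr_eq0 -normr_eq0; apply/eqP/le_anti/andP.
  split=> //; apply/ler_addgt0Pr => e e0; rewrite add0r.
  pose M := 3 / 2 * (`|a *: x + y| + `|a| * `|x| + `|y|) + 1.
  have M0 : 0 < M by rewrite /M ltr_wpDl// !mulr_ge0// !addr_ge0// mulr_ge0.
  have [k hk] := @geometric_small 3^-1 (e / M) ltac:(lra) ltac:(lra)
    (divr_gt0 e0 M0).
  rewrite (_ : f (a *: x + y) - _ = (f (a *: x + y) - F k (a *: x + y))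
    - a * (f x - F k x) - (f y - F k y)); last by rewrite linearP; ring.
  apply: le_trans (ler_normB _ _) _.
  apply: le_trans (lerD (le_trans (ler_normB _ _) (lexx _)) (fF k y)) _.
  rewrite normrM; have := fF k (a *: x + y).
  have := ler_wpM2l (normr_ge0 a) (fF k x).
  move: hk; rewrite ltr_pdivlMr// /M /c.
  have := exprn_ge0 k (_ : 0 <= 3^-1 :> R) => /(_ ltac:(lra)).
  by move: (3^-1 ^+ k) => q; lra.
pose fl : {scalar X} := HB.pack f (GRing.isLinear.Build _ _ _ _ _ flin).
have fc : continuous (fl : X -> R).
  move=> x; apply/cvgrPdist_le => e e0; near=> y.
  rewrite -raddfB; have := fF 0%N (x - y); rewrite F0 subr0 /c expr0 mulr1.
  move=> /le_trans; apply.
  have : `|x - y| <= e / 2 by near: y; apply: cvgr_dist_le => //; lra.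
  lra.
by exists (exist _ fl fc).
Unshelve. all: by end_near. Qed.

(** A gliding hump.  If [C] contains [x_k] of norm at least [2 k 3^k], correct
    a functional step by step: at step [k] add [+3^-k] or [-3^-k] times a
    norming functional of [x_k], with the sign for which the value at [x_k] is
    at least [3^-k |x_k|].  All later corrections together change that value by
    at most half of this, so the limit functional is unbounded on [C], although
    it is weakly continuous. *)
Theorem weakly_compact_bounded C : weakly_compact C ->
  exists M, forall x : X, C x -> `|x| <= M.
Proof.
move=> Cco; apply: contrapT => nb.
have /choice[x hx] : forall k : nat, exists x : X,
    C x /\ 2 * k%:R <= 3^-1 ^+ k * `|x|.
  move=> k; apply: contrapT => nx; apply: nb; exists (2 * k%:R * 3 ^+ k) => x Cx.
  rewrite leNgt; apply/negP => hx; apply: nx; exists x; split => //.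
  by rewrite exprVn [leRHS]mulrC ler_pdivlMr ?exprn_gt0// ltW.
have [N hN] := choice (fun d : X => norming_functional d).
have FP (G : {scalar X}) k : exists H : {scalar X},
    (forall y, `|H y - G y| <= 3^-1 ^+ k * `|y|) /\
    3^-1 ^+ k * `|x k| <= `|H (x k)|.
  pose e : R := if 0 <= G (x k) then 1 else - 1.
  have q0 : 0 <= 3^-1 ^+ k :> R by rewrite exprn_ge0.
  exists (G \+ ((e * 3^-1 ^+ k) \*: sval (N (x k)))); split=> [y|] /=.
    rewrite addrC addKr normrM; apply: ler_pM => //; last exact: (hN _).1.
    rewrite normrM [`|_ ^+ _|]ger0_norm// /e; case: ifP => _;
      rewrite ?normrN normr1; lra.
  rewrite -[X in `|_ + X|]/(e * 3^-1 ^+ k * sval (N (x k)) (x k)).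
  rewrite (hN (x k)).2 /e; case: ifPn => [G0|]; last rewrite -ltNge => G0.
    rewrite ger0_norm; first by lra.
    by rewrite addr_ge0// !mulr_ge0.
  rewrite ler0_norm; first by lra.
  have : 0 <= 3^-1 ^+ k * `|x k| by rewrite mulr_ge0.
  lra.
have /choice[g hg] : forall p : nat * {scalar X}, exists H : {scalar X},
    (forall y, `|H y - p.2 y| <= 3^-1 ^+ p.1 * `|y|) /\
    3^-1 ^+ p.1 * `|x p.1| <= `|H (x p.1)| by case=> k G; exact: FP.
pose F := fix F k : {scalar X} := if k is k'.+1 then g (k', F k') else \0.
have [//|k y|f hf] := @dual_limit F; first exact: (hg (k, F k)).1.
have [M hM] := dual_bounded_on f Cco.
pose k := (Num.truncn M).+1.
have Mk : M < k%:R by exact: truncnS_gt.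
have := hM _ (hx k).1; have := (hx k).2; have := (hg (k, F k)).2 => /=.
have := hf k.+1 (x k); rewrite exprS.
have := ler_distD 0 (sval f (x k)) (F k.+1 (x k)).
have := lerB_dist (F k.+1 (x k)) (sval f (x k)).
rewrite [`|_ - sval f _|]distrC /=.
by move: (3^-1 ^+ k) (sval f (x k)) => q fx; lra.
Qed.

End Boundedness.

(** * Minimal invariant sets *)

Lemma increasing_seq_ge (phi : nat -> nat) n : increasing_seq phi -> (n <= phi n)%N.
Proof.
move=> phi_incr; elim: n => // n IH; apply: leq_ltn_trans IH _.
by rewrite ltnNge -[(_ <= _)%N]/(phi n.+1 <= phi n)%O phi_incr -ltnNge.
Qed.

Section MinimalInvariantSet.
Variables (R : realType) (X : normedModType R).

(** A norm limit of points of [C] is also the limit of a weakly convergent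
    subsequence in [C]. *)
Lemma weakly_compact_closed C : weakly_compact C -> closed (C : set X).
Proof.
move=> Cco x clx; have /choice[y hy] : forall n : nat, exists y,
    C y /\ `|y - x| < n.+1%:R^-1.
  move=> n; have [y [Cy]] := clx _ (nbhsx_ballx x n.+1%:R^-1 ltac:(by [])).
  by rewrite -ball_normE /= distrC; exists y.
have [phi [v [phi_incr Cv yv]]] :=
  weakly_compact_subsequence Cco (fun n => (hy n).1).
suff -> : x = v by [].
apply/eqP; rewrite eq_sym -subr_eq0 -normr_eq0; apply/eqP/le_anti/andP; split=> //.
apply/ler_addgt0Pr => e e0; rewrite add0r.
apply: (wcvg_norm_le (wcvgB yv (@wcvg_cst _ _ x))).
have [N _ hN] := near_infty_natSinv_lt (PosNum e0).
exists N => // n Nn.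
have phin := increasing_seq_ge n phi_incr.
apply: le_trans (ltW (hy (phi n)).2) _.
exact/ltW/(hN _ (leq_trans Nn phin)).
Qed.

Definition invariant_body (T : X -> X) : set (set X) :=
  [set A | [/\ A !=set0, closed A, convex_set A & set_fun A A T]].

(** The members of the chain generate a filter on [C].  They are weakly closed,
    so a weak cluster point of that filter belongs to all of them. *)
Lemma chain_bigcap_nonempty C (F : set (set X)) : weakly_compact C ->
    F !=set0 -> total_on F (fun A B => B `<=` A) ->
    (forall A, F A -> [/\ A `<=` C, A !=set0, closed A & convex_set A]) ->
  \bigcap_(A in F) A !=set0.
Proof.
move=> Cco [A0 FA0] totF FP; pose G := filter_from F id.
have GF : ProperFilter G.
  apply: filter_from_proper; last by move=> A /FP[].
  apply: filter_from_filter; first by exists A0.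
  move=> A B FA FB; have [BA|AB] := totF _ _ FA FB.
  - by exists B => // x Bx; split => //; exact: BA.
  - by exists A => // x Ax; split => //; exact: AB.
have [|v [Cv clv]] := Cco G GF; first by exists A0 => //; by have [] := FP _ FA0.
exists v => A FA; have [_ _ Acl Acv] := FP _ FA.
apply: (closed_convex_weakly_closed Acl Acv) => B vB.
by apply: clv vB; exists A.
Qed.

Lemma minimal_invariant_body C T : weakly_compact C -> invariant_body T C ->
  exists K, [/\ K `<=` C, invariant_body T K &
    forall A, A `<=` K -> invariant_body T A -> A = K].
Proof.
move=> Cco CT.
have [||||K [KC KT] Kmin] := @Zorn_in (set X)
    [set A | A `<=` C /\ invariant_body T A] (fun A B => B `<=` A).
- by move=> A; exact: subset_refl.
- by move=> A B D AB BD; exact: subset_trans AB.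
- by move=> A B BA AB; exact/seteqP.
- move=> F FP totF; have [F0|/set0P/negP/negPn/eqP ->] := pselect (F !=set0);
    last by exists C => //; split; [exact: subset_refl|].
  exists (\bigcap_(A in F) A); last by move=> A FA; exact: bigcap_inf.
  split; first by have [A FA] := F0; move=> x /(_ A FA); exact: (FP _ FA).1.
  split.
  + apply: (chain_bigcap_nonempty Cco F0 totF) => A /FP[AC [? ? ? ?]].
    by split.
  + by apply: closed_bigI => A /FP[_ []].
  + apply/convex_setP => x y s s0 s1 Fx Fy A FA.
    have [_ [_ _ /convex_setP Acv _]] := FP _ FA.
    by apply: Acv => //; [exact: Fx|exact: Fy].
  + move=> x Fx A FA; have [_ [_ _ _ AT]] := FP _ FA.
    by apply: AT; exact: Fx.
exists K; split=> // A AK AT; apply: Kmin => //.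
by split=> //; exact: subset_trans KC.
Qed.

End MinimalInvariantSet.

(** * Uniform asymptotic regularity of averaged iterations *)

Section Combinations.
Variables (R : realType) (X : normedModType R).
Implicit Types (x y u v : X) (s : R).

Lemma comboBB s x y u v : (s *: x + (1 - s) *: y) - (s *: u + (1 - s) *: v) =
  s *: (x - u) + (1 - s) *: (y - v).
Proof. by rewrite !scalerBr opprD addrACA. Qed.

Lemma combo_id s v : s *: v + (1 - s) *: v = v.
Proof. by rewrite -scalerDl addrC subrK scale1r. Qed.

Lemma normB_combo s x y u v : 0 <= s -> s <= 1 ->
  `|(s *: x + (1 - s) *: y) - (s *: u + (1 - s) *: v)| <=
  s * `|x - u| + (1 - s) * `|y - v|.
Proof.
move=> s0 s1; rewrite comboBB; apply: le_trans (ler_normD _ _) _.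
by rewrite !normrZ !ger0_norm// subr_ge0.
Qed.

Lemma normB_combol s x y v : 0 <= s -> s <= 1 ->
  `|(s *: x + (1 - s) *: y) - v| <= s * `|x - v| + (1 - s) * `|y - v|.
Proof. by move=> s0 s1; rewrite -[X in _ - X](combo_id s) normB_combo. Qed.

Lemma combo_subr s x y : (s *: x + (1 - s) *: y) - y = s *: (x - y).
Proof. by rewrite -[X in _ - X](combo_id s) comboBB subrr scaler0 addr0. Qed.

Lemma combo_subl s x y : (s *: x + (1 - s) *: y) - x = (1 - s) *: (y - x).
Proof. by rewrite -[X in _ - X](combo_id s) comboBB subrr scaler0 add0r. Qed.

End Combinations.

Section AsymptoticRegularity.
Variables (R : realType) (X : normedModType R) (l : R).
Hypotheses (l0 : 0 < l) (l1 : l < 1).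

Let bernoulli n : 1 + n%:R * l <= (1 - l) ^- n.
Proof.
have q0 : 0 < 1 - l by rewrite subr_gt0.
elim: n => [|n IH]; first by rewrite expr0 invr1 mul0r addr0.
rewrite exprS invfM -natr1; set c := (_ ^- n) in IH *.
rewrite [leRHS]mulrC ler_pdivlMr//.
have : 0 <= n%:R * l * l by rewrite !mulr_ge0// ltW.
have : 0 <= l * l by rewrite mulr_ge0 ?normr_ge0// ltW.
lra.
Qed.

Section KrasnoselskiiSequence.
Variables z w : nat -> X.
Hypothesis zS : forall k, z k.+1 = l *: w k + (1 - l) *: z k.
Hypothesis wS : forall k, `|w k.+1 - w k| <= `|z k.+1 - z k|.
Let d k := `|z k - w k|.

Let zSB k : `|z k.+1 - z k| = l * d k.
Proof. by rewrite zS combo_subr normrZ gtr0_norm// distrC. Qed.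

Lemma krasnoselskii_noninc k : d k.+1 <= d k.
Proof.
have : `|z k.+1 - w k| = (1 - l) * d k.
  by rewrite zS combo_subl normrZ gtr0_norm// subr_gt0.
have := ler_distD (w k) (z k.+1) (w k.+1); have := wS k.
by rewrite zSB [`|w k - w k.+1|]distrC -/(d k.+1); lra.
Qed.

Lemma krasnoselskii_noninc_le i j : (i <= j)%N -> d j <= d i.
Proof.
move: i j; apply: (homo_leq (f := d) (r := fun x y : R => y <= x)) => //.
- by move=> a b c /[swap]; exact: le_trans.
- exact: krasnoselskii_noninc.
Qed.

Let w_far i n : `|w (i + n)%N - w i| <= n%:R * l * d i.
Proof.
elim: n => [|n IH]; first by rewrite addn0 subrr normr0 !mul0r.
apply: le_trans (ler_distD (w (i + n)%N) _ _) _; rewrite addnS -natr1.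
have := wS (i + n); rewrite zSB.
have := ler_wpM2l (ltW l0) (krasnoselskii_noninc_le (leq_addr n i)); lra.
Qed.

(** The Goebel-Kirk inequality: if [d] hardly decreases over [n] steps, then
    [w (i + n)] must be about [1 + n l] times [d i] away from [z i], because the
    iteration keeps drifting in one direction.  Induction on [n], from
    [i + 1] to [i]. *)
Lemma goebel_kirk i n :
  (1 + n%:R * l) * d i <=
  `|z i - w (i + n)%N| + (1 - l) ^- n * (d i - d (i + n)%N).
Proof.
elim: n i => [|n IH] i; first by rewrite addn0 mul0r addr0 subrr mulr0 addr0 mul1r.
have := IH i.+1; rewrite addSnnS.
set b := d (i + n.+1)%N; set a := `|z i - w _|.
have q0 : 0 < 1 - l by rewrite subr_gt0.
have : `|z i.+1 - w (i + n.+1)%N| <= l * (n.+1%:R * l * d i) + (1 - l) * a.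
  rewrite zS; apply: le_trans (normB_combol _ _ _ (ltW l0) (ltW l1)) _.
  rewrite lerD2r; apply: ler_wpM2l; first exact: ltW.
  rewrite distrC; exact: w_far.
have := krasnoselskii_noninc i; have := bernoulli n.
rewrite exprS invfM; set c := _ ^- n; set e := `|_ - _|.
move: (d i.+1) (d i) => d1 d0 cb d10 eb H.
have : (1 - l) * ((1 + n.+1%:R * l) * d0) <= (1 - l) * a + c * (d0 - b).
  have : (1 + n%:R * l) * (d0 - d1) <= c * (d0 - d1).
    by apply: ler_wpM2r => //; rewrite subr_ge0.
  by move: eb H; rewrite -natr1; lra.
move=> H'; rewrite -(ler_pM2l q0) mulrDr !mulrA divff ?gt_eqF// mul1r.
by rewrite -mulrA.
Qed.

End KrasnoselskiiSequence.

(** Choose [n] with [n l e > D + 1], where [D] bounds the distances.  As long as [d] exceeds [e], the Goebel-Kirk inequality forces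
    [(1 - l)^-n d] to drop by at least [1] over each block of [n] steps, which
    can happen only a number of times that is bounded in terms of [D]. *)
Lemma uniform_asymptotic_regularity D e : 0 < e -> exists N,
  forall z w : nat -> X,
    (forall k, z k.+1 = l *: w k + (1 - l) *: z k) ->
    (forall k, `|w k.+1 - w k| <= `|z k.+1 - z k|) ->
    (forall i j, `|z i - w j| <= D) -> `|z N - w N| <= e.
Proof.
move=> e0; pose n := (Num.truncn ((D + 1) / (e * l))).+1.
have nD : D + 1 < n%:R * l * e.
  have : (D + 1) / (e * l) < n%:R by exact: truncnS_gt.
  by rewrite ltr_pdivrMr ?mulr_gt0//; lra.
have q0 : 0 < 1 - l by rewrite subr_gt0.
pose c := (1 - l) ^- n; have c0 : 0 < c by rewrite invr_gt0 exprn_gt0.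
pose L := (Num.truncn (c * D)).+1; have cL : c * D < L%:R by exact: truncnS_gt.
exists (L * n)%N => z w zS wS zwD; rewrite leNgt; apply/negP => eN.
pose d k := `|z k - w k|.
have drop j : (j < L)%N -> c * d (j.+1 * n)%N <= c * d (j * n)%N - 1.
  move=> jL; have := goebel_kirk zS wS (j * n) n; rewrite -/c addnC -mulSn.
  have : e < d (j * n)%N.
    by apply: lt_le_trans eN _; apply: krasnoselskii_noninc_le => //;
    rewrite leq_mul2r ltnW ?orbT.
  have := zwD (j * n)%N (j.+1 * n)%N; rewrite -/(d _) -/(d _).
  have : 0 < n%:R * l by rewrite mulr_gt0.
  move: (d _) (d _) => d1 d2; move: (_ - _) => u.
  by nra.
have H j : (j <= L)%N -> c * d (j * n)%N <= c * D - j%:R.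
  elim: j => [|j IH] jL; first by rewrite subr0 ler_wpM2l ?(ltW c0)//; exact: zwD.
  by have := drop j jL; have := IH (ltnW jL); rewrite -natr1; lra.
have := H L (leqnn L); have : 0 <= c * d (L * n)%N by exact/mulr_ge0/normr_ge0/ltW.
lra.
Qed.

End AsymptoticRegularity.

(** * The coefficient M(X) *)

Section CoefficientM.
Variables (R : realType) (X : normedModType R).

Lemma limn_esup_le (u : nat -> \bar R) M :
  (\forall n \near \oo, (u n <= M)%E) -> (limn_esup u <= M)%E.
Proof.
move=> uM; apply: (@le_trans _ _ (ereal_sup [set u n | n in [set n | (u n <= M)%E]])).
  by apply: ereal_inf_lbound; exists [set n | (u n <= M)%E].
by apply: ge_ereal_sup => _ [n un <-].
Qed.

Lemma limn_einf_ge (u : nat -> \bar R) M :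
  (forall n, (M <= u n)%E) -> (M <= limn_einf u)%E.
Proof.
move=> uM; rewrite /limn_einf leeNr; apply: limn_esup_le.
by exists 0%N => // n _; rewrite leeN2.
Qed.

(** What a number [r] above [R(a, X)] provides for sequences whose mutual
    distances are eventually at most [1]; that [|y n| <= 1] then follows, by
    [separation_le1_bounded]. *)
Definition R_witness (a r : R) := forall (x : X) (y : nat -> X), `|x| <= a ->
  (forall n, \forall m \near \oo, `|y n - y m| <= 1) -> wcvg y 0 ->
  exists n, `|y n + x| <= r.

(** For fixed [n], the vectors [y n - y m] converge weakly to [y n]. *)
Lemma separation_le1_bounded (y : nat -> X) :
  (forall n, \forall m \near \oo, `|y n - y m| <= 1) -> wcvg y 0 ->
  forall n, `|y n| <= 1.
Proof.
move=> y1 y0 n; rewrite -[y n]subr0.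
exact: wcvg_norm_le (wcvgB (@wcvg_cst _ _ (y n)) y0) (y1 n).
Qed.

Lemma param_R_witness a r r' : (param_R X a <= r%:E)%E -> r < r' ->
  R_witness a r'.
Proof.
move=> Rr rr' x y xa y1 y0; apply: contrapT => ny.
suff : (r'%:E <= param_R X a)%E.
  by move=> /le_trans/(_ Rr); rewrite lee_fin leNgt rr'.
apply: (@le_trans _ _ (limn_einf (fun n => `|y n + x|%:E))).
  apply: limn_einf_ge => n; rewrite lee_fin leNgt; apply/negP => yr.
  by apply: ny; exists n; exact: ltW.
apply: ereal_sup_ubound; exists x, y; split=> //.
- exact: separation_le1_bounded.
- exact/weakly_nullP.
- apply: limn_esup_le; exists 0%N => // n _; apply: limn_esup_le.
  by apply: filterS (y1 n) => m; rewrite lee_fin.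
Qed.

(** With [s = b / a], the vector [y n + x] is the average, with weights [s] and
    [1 - s], of [y n + x / s] and [y n]. *)
Lemma R_witness_scale a r b : 0 < b -> b <= a -> R_witness a r ->
  R_witness b (1 + b / a * (r - 1)).
Proof.
move=> b0 ba ar x y xb y1 y0; have a0 : 0 < a by lra.
have [|n hn] := ar ((a / b) *: x) y _ y1 y0.
  have ab0 : 0 <= a / b by rewrite divr_ge0// ltW.
  rewrite normrZ (ger0_norm ab0) -[leRHS](divfK (lt0r_neq0 b0)).
  exact: ler_wpM2l.
exists n; have yn := separation_le1_bounded y1 y0 n.
set s := b / a; have s0 : 0 <= s by rewrite divr_ge0// ltW.
have s1 : s <= 1 by rewrite ler_pdivrMr// mul1r.
have sK : s * (a / b) = 1 by rewrite /s; field; rewrite !gt_eqF.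
move: s s0 s1 sK => s s0 s1 sK.
have -> : y n + x = s *: (y n + (a / b) *: x) + (1 - s) *: y n.
  by rewrite scalerDr scalerA sK scale1r addrAC combo_id.
apply: le_trans (ler_normD _ _) _; rewrite !normrZ (ger0_norm s0).
by rewrite (@ger0_norm _ (1 - s)) ?subr_ge0//; nra.
Qed.

Lemma R_witness_add a r b : 0 <= a -> R_witness a r ->
  R_witness b (r + b).
Proof.
move=> a0 ar x y xb y1 y0.
have [|n hn] := ar 0 y _ y1 y0; first by rewrite normr0.
exists n; apply: le_trans (ler_normD _ _) _; rewrite addr0 in hn; exact: lerD.
Qed.

(** The supremum defining [M(X)] may only be approached at a large [a], or at
    [a = 0]; scaling down, preceded in the second case by passing to [a = 1],
    yields an arbitrarily small positive [a]. *)
Lemma M_gt1_R_witness e : (1 < param_M X)%E -> 0 < e ->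
  exists a r, [/\ 0 < a, a <= e, r < 1 + a & R_witness a r].
Proof.
move=> /ereal_sup_gt[_ [a /= a0 <-] Ma] e0.
have R0 : (0 <= param_R X a)%E.
  apply: ereal_sup_ubound; exists 0, (fun=> 0); split=> //.
  - by rewrite normr0.
  - by move=> _; rewrite normr0.
  - exact/weakly_nullP/wcvg_cst.
  - apply: limn_esup_le; exists 0%N => // n _; apply: limn_esup_le.
    by exists 0%N => // m _; rewrite lee_fin subrr normr0.
  - apply/le_anti/andP; split.
      by apply: limn_einf_ge => n; rewrite lee_fin.
    apply: le_trans (limn_einf_sup _) _; apply: limn_esup_le.
    by exists 0%N => // n _; rewrite lee_fin addr0 normr0.
have [r [Rr ra]] : exists r, (param_R X a <= r%:E)%E /\ r < 1 + a.
  move: R0 Ma; case: (param_R X a) => [q| |] //; last first.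
    by rewrite invey mule0 ltNge lee01.
  rewrite lee_fin inver => q0; case: eqP => [-> _|/eqP qn0].
    by exists 0; split => //; lra.
  have {}q0 : 0 < q by rewrite lt_neqAle eq_sym qn0.
  rewrite -EFinM lte_fin ltr_pdivlMr// mul1r => qa.
  by exists q.
have [a1 [r1 [a10 ra1 ar1]]] : exists a1 r1,
    [/\ 0 < a1, r1 < 1 + a1 & R_witness a1 r1].
  have aw : R_witness a ((r + 1 + a) / 2) by apply: param_R_witness Rr _; lra.
  have [a00|a00] := eqVneq a 0.
    exists 1, ((r + 1 + a) / 2 + 1); split; [lra| |]; first by rewrite a00 in ra *; lra.
    exact: R_witness_add aw.
  by exists a, ((r + 1 + a) / 2); split => //; [rewrite lt_neqAle eq_sym a00|lra].
pose b := Num.min a1 e; have b0 : 0 < b by rewrite lt_min a10 e0.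
have ba : b <= a1 by rewrite ge_min lexx.
exists b, (1 + b / a1 * (r1 - 1)); split => //.
- by rewrite ge_min lexx orbT.
- rewrite ltrD2l -[ltRHS](@divfK _ a1) ?gt_eqF// ltr_pM2l ?divr_gt0//; lra.
- exact: R_witness_scale.
Qed.

End CoefficientM.

(** * Approximate fixed points in a minimal set *)

Section GeneralizedNonexpansive.
Variables (R : realType) (X : normedModType R).
Implicit Types (K : set X) (T : X -> X).

(** Approximate fixed points do not get farther from [T x] than they are from
    [x], asymptotically.  This is the part of nonexpansiveness that the
    invariance of asymptotic balls needs. *)
Definition afp_stable K T := forall x, K x -> forall e, 0 < e ->
  exists2 d, 0 < d & forall u, K u -> `|u - T u| <= d ->
    `|u - T x| <= `|u - x| + e.

(** Condition (C) applies to [(x, y)] or to [(T x, y)]: otherwise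
    [|x - T x| <= |x - y| + |T x - y|] would be less than
    [(|x - T x| + |T x - T (T x)|) / 2 <= |x - T x|]. *)
Lemma condC_suzuki K T x y : set_fun K K T -> condC K T -> K x -> K y ->
  `|x - T y| <= 3 * `|x - T x| + `|x - y|.
Proof.
move=> KT TC Kx Ky; have KTx := KT _ Kx.
have xTx : 2^-1 * `|x - T x| <= `|x - T x| by have := normr_ge0 (x - T x); lra.
have TTx := TC _ _ Kx KTx xTx.
have D1 := ler_distD (T x) x (T y).
have [xy|xy] := leP (2^-1 * `|x - T x|) `|x - y|.
  by have := TC _ _ Kx Ky xy; have := normr_ge0 (x - T x); lra.
have D2 := ler_distD (T (T x)) (T x) (T y).
have D3 := ler_distD x (T x) y; rewrite [`|T x - x|]distrC in D3.
have D4 := ler_distD y x (T x); rewrite [`|y - T x|]distrC in D4.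
have h : 2^-1 * `|T x - T (T x)| <= `|T x - y| by lra.
by have := TC _ _ KTx Ky h; lra.
Qed.

Lemma condC_afp_stable K T : set_fun K K T -> condC K T -> afp_stable K T.
Proof.
move=> KT TC x Kx e e0; exists (e / 3); first by lra.
by move=> u Ku ud; have := condC_suzuki KT TC Ku Kx; lra.
Qed.

(** Since [T x != x], continuity keeps points with small displacement away from
    [x], so that the premise of the condition holds for the pair [(u, x)]. *)
Lemma continuous_afp_stable C K T l : 0 < l -> l < 1 -> K `<=` C ->
  {within C, continuous T} -> condC_ l K T -> (forall x, K x -> T x != x) ->
  afp_stable K T.
Proof.
move=> l0 l1 KC Tc TC nfix x Kx e e0; pose r := `|x - T x|.
have r0 : 0 < r by rewrite normr_gt0 subr_eq0 eq_sym nfix.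
have /nbhs_ballP[d /= d0 hd] : \forall u \near x, C u -> `|T x - T u| < r / 4.
  have /subspace_continuousP/(_ x (KC _ Kx)) := Tc.
  by move=> /cvgrPdist_lt; apply; lra.
exists (Num.min (r / 4) (Num.min d e)).
  by rewrite !lt_min d0 e0 andbT; lra.
move=> u Ku; rewrite !le_min => /and3P[ur ud ue].
have xu : r / 4 <= `|u - x| \/ d <= `|u - x|.
  have [?|ux4] := leP (r / 4) `|u - x|; [by left|right].
  rewrite leNgt; apply/negP => ux.
  have := hd u; rewrite -ball_normE /= distrC => /(_ ux (KC _ Ku)).
  have := ler_distD u x (T x); have := ler_distD (T u) u (T x).
  by rewrite [`|x - u|]distrC [`|T x - T u|]distrC -/r; lra.
have lu : l * `|u - T u| <= `|u - x|.
  apply: (@le_trans _ _ `|u - T u|); first by rewrite ler_piMl// ltW.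
  by case: xu => ?; lra.
have := TC _ _ Ku Kx lu; have := ler_distD (T u) u (T x); lra.
Qed.

Definition afp_sequence K T (u : nat -> X) := (forall n, K (u n)) /\
  forall d, 0 < d -> \forall n \near \oo, `|u n - T (u n)| <= d.

Lemma harmonic_afp_sequence K T (u : nat -> X) : (forall n, K (u n)) ->
  (forall n, `|u n - T (u n)| <= n.+1%:R^-1) -> afp_sequence K T u.
Proof.
move=> Ku ud; split => // d d0; have := near_infty_natSinv_lt (PosNum d0).
by apply: filterS => n /ltW; exact: le_trans.
Qed.

Section Minimal.
Variables (K : set X) (T : X -> X).
Hypothesis KT : invariant_body T K.
Hypothesis Kmin : forall A, A `<=` K -> invariant_body T A -> A = K.
Hypothesis Kstab : afp_stable K T.

(** The points satisfying the asymptotic bound form a closed convex subset of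
    [K], invariant by stability, hence all of [K] by minimality. *)
Lemma asymptotic_radius_constant u r x y : afp_sequence K T u ->
  K x -> (forall e, 0 < e -> \forall n \near \oo, `|u n - x| <= r + e) ->
  K y -> forall e, 0 < e -> \forall n \near \oo, `|u n - y| <= r + e.
Proof.
move=> [Ku uT] Kx xr Ky.
have [K0 Kcl /convex_setP Kcv KTK] := KT.
pose A := [set z | K z /\
  forall e, 0 < e -> \forall n \near \oo, `|u n - z| <= r + e].
suff AK : A = K by have [] : A y by rewrite AK.
apply: Kmin => [z []//|]; split.
- by exists x.
- move=> z clz; split; first by apply: Kcl => B /clz[a [[Ka _] Ba]]; exists a.
  move=> e e0; have e20 : 0 < e / 2 by lra.
  have [a [[_ /(_ _ e20) ar]]] := clz _ (nbhsx_ballx z (e / 2) e20).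
  rewrite -ball_normE /= distrC => az; apply: filterS ar => n.
  have := ler_distD a (u n) z; lra.
- apply/convex_setP => a b s s0 s1 [Ka ar] [Kb br]; split; first exact: Kcv.
  move=> e e0; apply: filterS2 (ar e e0) (br e e0) => n an bn.
  rewrite distrC; apply: le_trans (normB_combol _ _ _ s0 s1) _.
  by rewrite distrC [`|b - _|]distrC; nra.
- move=> z [Kz zr]; split; first exact: KTK.
  move=> e e0; have e20 : 0 < e / 2 by lra.
  have [d d0 hd] := Kstab Kz e20.
  apply: filterS2 (uT d d0) (zr _ e20) => n un.
  have := hd _ (Ku n) un; lra.
Qed.

Hypothesis nfix : forall x, K x -> T x != x.
Hypothesis afp_ex : forall d, 0 < d -> exists2 u, K u & `|u - T u| <= d.
Hypothesis Kbd : exists M, forall x, K x -> `|x| <= M.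

Definition afp_distance_lb c := forall x, K x -> forall e, 0 < e ->
  exists2 d, 0 < d & forall w, K w -> `|w - T w| <= d -> c - e <= `|w - x|.

(** Fix [p] in [K] and let [c] be the limit, as the displacement tends to [0],
    of the distance from [p] to the approximate fixed points.  A sequence
    attaining [c] at [p] has asymptotic radius at most [c] at every point of
    [K].  Conversely, approximate fixed points staying within [c - e] of some
    [x] would by the same lemma come within [c - e / 2] of [p]. *)
Lemma minimal_afp_sequence : exists c u, [/\ 0 < c, afp_sequence K T u,
    forall x, K x -> forall e, 0 < e -> \forall n \near \oo, `|u n - x| <= c + e
  & afp_distance_lb c].
Proof.
have [[p Kp] _ _ KTK] := KT; have [M hM] := Kbd.
pose G := [set r | exists2 d, 0 < d & forall w, K w -> `|w - T w| <= d ->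
  r <= `|w - p|].
have Gsup : has_sup G.
  split; first by exists 0; exists 1.
  exists (M + M) => r [d d0 hd]; have [w Kw wd] := afp_ex d0.
  have := hd w Kw wd; have := ler_normB w p; have := hM w Kw; have := hM p Kp.
  lra.
pose c := sup G.
have cp e : 0 < e -> exists2 d, 0 < d &
    forall w, K w -> `|w - T w| <= d -> c - e <= `|w - p|.
  move=> e0; have [r [d d0 hd] rc] := sup_adherent e0 Gsup.
  by exists d => // w Kw wd; have := hd w Kw wd; rewrite -/c in rc; lra.
have /choice[u hu] : forall n : nat, exists w, [/\ K w,
    `|w - T w| <= n.+1%:R^-1 & `|w - p| <= c + n.+1%:R^-1].
  move=> n; have n0 : 0 < n.+1%:R^-1 :> R by [].
  apply: contrapT => nw; suff : c + n.+1%:R^-1 <= c by rewrite gerDl leNgt n0.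
  apply: ub_le_sup; first exact: Gsup.2.
  exists n.+1%:R^-1 => // w Kw wd; rewrite leNgt; apply/negP => wp.
  by apply: nw; exists w; split => //; exact: ltW.
have Au : afp_sequence K T u.
  by apply: harmonic_afp_sequence => n; have [] := hu n.
have up e : 0 < e -> \forall n \near \oo, `|u n - p| <= c + e.
  move=> e0; have := near_infty_natSinv_lt (PosNum e0).
  apply: filterS => n /= ne; have [_ _ /le_trans] := hu n; apply.
  by rewrite lerD2l ltW.
have ux x : K x -> forall e, 0 < e -> \forall n \near \oo, `|u n - x| <= c + e.
  by move=> Kx; apply: (asymptotic_radius_constant Au Kp up Kx).
exists c, u; split=> //.
  rewrite ltNge; apply/negP => c0; have /negP := nfix Kp; apply.
  rewrite -subr_eq0 -normr_eq0; apply/eqP/le_anti/andP; split=> //.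
  apply/ler_addgt0Pr => e e0; have e20 : 0 < e / 2 by lra.
  have [N _ hN] : \forall n \near \oo, `|T p - p| <= e.
    apply: filterS2 (ux _ (KTK _ Kp) _ e20) (ux _ Kp _ e20) => n.
    have := ler_distD (u n) (T p) p; rewrite [`|T p - u n|]distrC; lra.
  by rewrite add0r; exact: (hN N (leqnn N)).
move=> x Kx e e0; apply: contrapT => nd.
have /choice[w hw] : forall n : nat, exists w, [/\ K w,
    `|w - T w| <= n.+1%:R^-1 & `|w - x| <= c - e].
  move=> n; apply: contrapT => nw; apply: nd; exists n.+1%:R^-1 => // w Kw wd.
  rewrite leNgt; apply/negP => wx.
  by apply: nw; exists w; split => //; exact: ltW.
have Aw : afp_sequence K T w.
  by apply: harmonic_afp_sequence => n; have [] := hw n.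
have wx e' : 0 < e' -> \forall n \near \oo, `|w n - x| <= c - e + e'.
  by move=> e'0; exists 0%N => // n _; have [_ _] := hw n; rewrite /=; lra.
have e20 : 0 < e / 2 by lra.
have wp := asymptotic_radius_constant Aw Kx wx Kp e20.
have e40 : 0 < e / 4 by lra.
have [d d0 hd] := cp _ e40.
have [N _ hN] : \forall n \near \oo, False.
  apply: filterS2 wp (Aw.2 d d0) => n wn wd.
  by have := hd _ (Aw.1 n) wd; lra.
exact: (hN N (leqnn N)).
Qed.

End Minimal.

(** * Iterating between two approximate fixed points *)

Section KrasnoselskiiOperator.
Variables (K : set X) (T : X -> X) (l : R).
Hypotheses (l0 : 0 < l) (l1 : l < 1).
Hypotheses (KT : invariant_body T K) (TC : condC_ l K T).

Definition krasnoselskii (l : R) T (x : X) := l *: T x + (1 - l) *: x.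
Local Notation S := (krasnoselskii l T).

Lemma krasnoselskii_sub x : K x -> K (S x).
Proof.
move=> Kx; have [_ _ /convex_setP Kcv KTK] := KT.
by apply: Kcv => //; [exact: ltW|exact: ltW|exact: KTK].
Qed.

Lemma krasnoselskii_iter_sub k x : K x -> K (iter k S x).
Proof. by move=> Kx; elim: k => //= k; exact: krasnoselskii_sub. Qed.

Lemma krasnoselskii_iter_regular e : 0 < e ->
  (exists M, forall x, K x -> `|x| <= M) ->
  exists N, forall x, K x -> `|iter N S x - T (iter N S x)| <= e.
Proof.
move=> e0 [M hM]; have [_ _ _ KTK] := KT.
have [N hN] := uniform_asymptotic_regularity X l0 l1 (M + M) e0.
exists N => x Kx; pose z k := iter k S x.
have Kz k : K (z k) by exact: krasnoselskii_iter_sub.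
apply: (hN z (T \o z)) => [k|k|i j] //=.
- rewrite distrC [leRHS]distrC; apply: (TC (Kz k) (Kz k.+1)).
  by rewrite [leRHS]distrC /z iterS combo_subr normrZ gtr0_norm// distrC.
- apply: le_trans (ler_normB _ _) _.
  by apply: lerD; apply: hM => //; exact: KTK.
Qed.

Lemma krasnoselskii_nonexp x y : K x -> K y -> l * `|x - T x| <= `|x - y| ->
  `|S x - S y| <= `|x - y|.
Proof.
move=> Kx Ky xy; apply: le_trans (normB_combo _ _ _ _ (ltW l0) (ltW l1)) _.
have := ler_wpM2l (ltW l0) (TC Kx Ky xy); lra.
Qed.

Lemma krasnoselskii_dist x q : K x -> K q -> l * `|q - T q| <= `|x - q| ->
  `|S x - q| <= `|x - q| + `|q - T q| /\ `|x - T x| <= 2 * `|x - q| + `|q - T q|.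
Proof.
move=> Kx Kq; rewrite [`|x - q|]distrC => qx; have TqTx := TC Kq Kx qx.
have D := ler_distD (T q) q (T x).
have D' := ler_distD q x (T x); rewrite [`|x - q|]distrC in D'.
split; last by lra.
apply: le_trans (normB_combol _ _ _ (ltW l0) (ltW l1)) _.
rewrite [`|T x - q|]distrC [`|x - q|]distrC.
have := ler_wpM2l (ltW l0) (le_trans D (lerD (lexx _) TqTx)).
have : l * `|q - T q| <= `|q - T q| by rewrite ler_piMl// ltW.
lra.
Qed.

(** Here [A = (1 - t) c] and [B = t c], so that [|x n - p|] is about [A + B].
    The distances of the iterates to [x n] and to [p] are at most about [A] and
    [B], hence also at least about that, which dominates the displacements of
    [x n] and of [p]; so each step increases these distances by at most [h].
    Likewise, [x m] being about [A + B] away from the [n]-th iterate for large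
    [m], the [n]-th and [m]-th iterates are about [B] apart, whereas the
    displacement of the former is at most about [2 A]; as [2 A < B], the
    condition applies to this pair too. *)
Lemma krasnoselskii_between A B e h N (x z : nat -> X) p :
    3 * A <= B -> 0 < e -> 8 * e <= A -> 0 < h -> N.+1%:R * h <= e / 2 ->
    K p -> `|p - T p| <= h ->
    (forall n, K (x n)) -> (forall n, `|x n - T (x n)| <= h) ->
    (forall n, A + B - e / 2 <= `|x n - p|) ->
    (forall y, K y -> \forall m \near \oo, A + B - e <= `|x m - y|) ->
    (forall n, K (z n)) -> (forall n, `|z n - x n| <= A + e / 2) ->
    (forall n, `|z n - p| <= B + e / 2) ->
    (forall n, \forall m \near \oo, `|z n - z m| <= B + e) ->
  let z' n := iter N S (z n) in
  (forall n, `|z' n - x n| <= A + e) /\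
  (forall n, \forall m \near \oo, `|z' n - z' m| <= B + e).
Proof.
move=> AB e0 eA h0 Nh Kp ph Kx xh xp xfar Kz zx zp zz /=.
have he : h <= e / 2.
  by apply: le_trans Nh; rewrite ler_peMl ?ler1n// ltW.
have khe k : (k <= N)%N -> k%:R * h <= e / 2 - h.
  move=> kN; have : k.+1%:R * h <= N.+1%:R * h by rewrite ler_wpM2r ?ler_nat// ltW.
  by rewrite -natr1; lra.
pose y k n := iter k S (z n).
have Ky k n : K (y k n) by exact: krasnoselskii_iter_sub.
suff H k : (k <= N)%N -> [/\ forall n, `|y k n - x n| <= A + e / 2 + k%:R * h,
    forall n, `|y k n - p| <= B + e / 2 + k%:R * h &
    forall n, \forall m \near \oo, `|y k n - y k m| <= B + e].
  have [yx _ yy] := H N (leqnn N); split=> // n.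
  by have := yx n; have := khe N (leqnn N); rewrite /y; lra.
elim: k => [_|k IH kN].
  by split => // n; rewrite mul0r addr0; [exact: zx|exact: zp].
have [yx yp yy] := IH (ltnW kN); have kh := khe k (ltnW kN).
have lh q : `|q - T q| <= h -> l * `|q - T q| <= h.
  by move=> qh; apply: le_trans qh; rewrite ler_piMl// ltW.
have stepx n : l * `|x n - T (x n)| <= `|y k n - x n|.
  apply: le_trans (lh _ (xh n)) _.
  have := ler_distD (y k n) (x n) p; rewrite [`|x n - y k n|]distrC.
  by have := xp n; have := yp n; lra.
have stepp n : l * `|p - T p| <= `|y k n - p|.
  apply: le_trans (lh _ ph) _.
  have := ler_distD (y k n) (x n) p; rewrite [`|x n - y k n|]distrC.
  by have := xp n; have := yx n; lra.
split=> [n|n|n].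
- have [] := krasnoselskii_dist (Ky k n) (Kx n) (stepx n).
  by have := yx n; have := xh n; rewrite -natr1 /y /=; lra.
- have [] := krasnoselskii_dist (Ky k n) Kp (stepp n).
  by have := yp n; have := ph; rewrite -natr1 /y /=; lra.
- apply: filterS2 (yy n) (xfar _ (Ky k n)) => m ynm xm.
  apply: le_trans ynm; apply: (krasnoselskii_nonexp (Ky k n) (Ky k m)).
  apply: (@le_trans _ _ `|y k n - T (y k n)|); first by rewrite ler_piMl// ltW.
  have [_] := krasnoselskii_dist (Ky k n) (Kx n) (stepx n).
  have := ler_distD (y k m) (x m) (y k n).
  rewrite [`|x m - y k m|]distrC [`|y k m - y k n|]distrC.
  have := yx n; have := yx m; have := xh n; lra.
Qed.

End KrasnoselskiiOperator.

(** * The fixed point theorem *)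

Lemma near_increasing_seq (phi : nat -> nat) (P : nat -> Prop) :
  increasing_seq phi -> (\forall n \near \oo, P n) ->
  \forall n \near \oo, P (phi n).
Proof.
move=> phi_incr [N _ hN]; exists N => // n /= Nn; apply: hN => /=.
by apply: leq_trans Nn (increasing_seq_ge n phi_incr).
Qed.

Theorem minimal_fixed_point C K T l : 0 < l -> l < 1 -> weakly_compact C ->
    (1 < param_M X)%E -> K `<=` C -> invariant_body T K ->
    (forall A, A `<=` K -> invariant_body T A -> A = K) ->
    condC_ l K T -> ((forall x, K x -> T x != x) -> afp_stable K T) ->
  exists2 x, K x & T x = x.
Proof.
move=> l0 l1 Cco M1 KC KT Kmin TC Kst; apply: contrapT => nfixp.
have nfix x : K x -> T x != x.
  by move=> Kx; apply/eqP => Tx; apply: nfixp; exists x.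
have Kstab := Kst nfix; have [K0 Kcl Kcvx KTK] := KT.
have Kbd : exists M, forall x, K x -> `|x| <= M.
  by have [M hM] := weakly_compact_bounded Cco; exists M => x /KC; exact: hM.
have Kco : weakly_compact K.
  apply: (subclosed_compact _ Cco KC).
  exact: closed_convex_weakly_closed.
have Kreg d (d0 : 0 < d) := krasnoselskii_iter_regular l0 l1 KT TC d0 Kbd.
have afp_ex d : 0 < d -> exists2 u, K u & `|u - T u| <= d.
  move=> d0; have [N hN] := Kreg d d0; have [x Kx] := K0.
  exists (iter N (krasnoselskii l T) x); last exact: hN.
  exact: krasnoselskii_iter_sub.
have [c [u [c0 [Ku uT] uc cfar]]] :=
  minimal_afp_sequence KT Kmin Kstab nfix afp_ex Kbd.
have [a [r [a0 a3 ra ar]]] := @M_gt1_R_witness _ X 3^-1 M1 ltac:(lra).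
have [phi [v [phi_incr Kv uv]]] := weakly_compact_subsequence Kco Ku.
pose t := (1 + a)^-1; have t1 : t * (1 + a) = 1 by rewrite mulVf// gt_eqF//; lra.
have t0 : 0 < t by rewrite invr_gt0; lra.
have t_le1 : t <= 1 by nra.
pose A := (1 - t) * c; pose B := t * c.
have ABc : A + B = c by rewrite /A /B; lra.
have AaB : A = a * B.
  by have : t * (1 + a) * c = c; [rewrite t1 mul1r|rewrite /A /B; lra].
have B0 : 0 < B by rewrite mulr_gt0.
have A0 : 0 < A by rewrite AaB mulr_gt0.
have AB3 : 3 * A <= B by rewrite AaB; nra.
pose kap := c * (1 - r * t).
have kap0 : 0 < kap by rewrite mulr_gt0//; nra.
(* [kap] is the gap [c - r t c]; [e] is small enough for the error terms to
   consume less than two thirds of it. *)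
pose e := Num.min (a * kap / (3 * (1 + a))) (A / 8).
have a10 : 0 < 1 + a by lra.
have e0 : 0 < e by rewrite lt_min !divr_gt0// mulr_gt0.
have eA : 8 * e <= A.
  have : e <= A / 8 by rewrite ge_min lexx orbT.
  lra.
have ek : (1 + a) * (e / a) <= kap / 3.
  have : e <= a * kap / (3 * (1 + a)) by rewrite ge_min lexx.
  rewrite ler_pdivlMr ?mulr_gt0// => H.
  rewrite mulrA ler_pdivrMr//; lra.
have k30 : 0 < kap / 3 by lra.
have [d d0 hd] := cfar v Kv _ k30.
have [N hN] := Kreg d d0.
pose h := e / 2 / N.+1%:R; have h0 : 0 < h by rewrite !divr_gt0.
have Nh : N.+1%:R * h <= e / 2 by rewrite /h mulrC divfK.
(* The number [N] of steps is fixed before [h], so the errors made in all the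
   steps add up to at most [e / 2]. *)
have [p Kp ph] := afp_ex h h0.
have e20 : 0 < e / 2 by lra.
have [dp dp0 hdp] := cfar p Kp _ e20.
have [n0 _ hn0] : \forall n \near \oo, [/\ `|u (phi n) - T (u (phi n))| <= h,
    c - e / 2 <= `|u (phi n) - p| & `|u (phi n) - p| <= c + e / 2].
  apply: (near_increasing_seq (P := fun n => [/\ `|u n - T (u n)| <= h,
    c - e / 2 <= `|u n - p| & `|u n - p| <= c + e / 2])) => //.
  apply: filterS3 (uT h h0) (uT dp dp0) (uc p Kp _ e20) => n un un' unp.
  by split => //; exact: hdp.
pose x n := u (phi (n + n0)%N).
have hx n := hn0 (n + n0)%N (leq_addl n n0); rewrite -/(x _) in hx.
have near_x (P : X -> Prop) : (\forall n \near \oo, P (u n)) ->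
    \forall n \near \oo, P (x n).
  move=> /(near_increasing_seq phi_incr)[m _ hm]; exists m => // n /= mn.
  by apply: hm => /=; exact: leq_trans mn (leq_addr _ _).
have xv : wcvg x v by move=> f; have := uv f; rewrite -(cvg_shiftn n0).
have Kx n : K (x n) by exact: Ku.
pose z n := t *: x n + (1 - t) *: p.
have /convex_setP Kcv := Kcvx.
have Kz n : K (z n) by apply: Kcv => //; exact: ltW.
have [||||||z'x z'z'] := @krasnoselskii_between K T l l0 l1 KT TC A B e h N
  x z p AB3 e0 eA h0 Nh Kp ph Kx _ _ _ Kz.
- by move=> n; have [] := hx n.
- by move=> n; rewrite ABc; have [] := hx n.
- move=> y Ky; apply: (near_x (fun w => A + B - e <= `|w - y|)).
  have [dy dy0 hdy] := cfar y Ky e e0.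
  by rewrite ABc; apply: filterS (uT dy dy0) => n; exact: hdy.
- move=> n; rewrite combo_subl normrZ ger0_norm ?subr_ge0// distrC.
  have [_ _ xp] := hx n.
  have := ler_wpM2l (_ : 0 <= 1 - t) xp; rewrite subr_ge0 => /(_ t_le1).
  by rewrite /A; nra.
- move=> n; rewrite combo_subr normrZ gtr0_norm//.
  by have [_ _ xp] := hx n; have := ler_wpM2l (ltW t0) xp; rewrite /B; nra.
- move=> n; have := uc (x n) (Kx n) _ e20.
  move=> /(near_x (fun w => `|w - x n| <= c + e / 2)); apply: filterS => m xm.
  rewrite comboBB subrr scaler0 addr0 normrZ gtr0_norm// distrC.
  by have := ler_wpM2l (ltW t0) xm; rewrite /B; nra.
pose z' n := iter N (krasnoselskii l T) (z n).
have Kz' n : K (z' n) by exact: krasnoselskii_iter_sub.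
have [psi [w [psi_incr Kw z'w]]] := weakly_compact_subsequence Kco Kz'.
(* Scaling by [B + e / a] rather than [B] absorbs the error [e]: it makes
   [A + e = a s], as [A = a B]. *)
pose s := B + e / a.
have ea : e <= e / a by rewrite ler_pdivlMr// ler_piMr ?ltW//; lra.
have s0 : 0 < s by rewrite /s; lra.
have wv : `|w - v| <= a * s.
  have xpsi : wcvg (x \o psi) v.
    move=> f; have := xv f => /cvgrPdist_lt xf; apply/cvgrPdist_lt => e' e'0.
    exact: (near_increasing_seq psi_incr (xf e' e'0)).
  have -> : a * s = A + e.
    by rewrite /s AaB mulrDr [a * (e / a)]mulrCA divff ?mulr1// gt_eqF.
  apply: (wcvg_norm_le (wcvgB z'w xpsi)).
  by exists 0%N => // n _; exact: z'x.
have [|n|f|n] := ar (s^-1 *: (w - v)) (fun n => s^-1 *: (z' (psi n) - w)).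
- by rewrite normrZ gtr0_norm ?invr_gt0// mulrC ler_pdivrMr.
- have := near_increasing_seq psi_incr (z'z' (psi n)); apply: filterS => m zm.
  rewrite -scalerBr opprB addrA subrK normrZ gtr0_norm ?invr_gt0//.
  by rewrite mulrC ler_pdivrMr// mul1r; apply: le_trans zm _; rewrite /s; lra.
- have := @wcvgZ _ _ _ _ s^-1 (wcvgB z'w (@wcvg_cst _ _ w)) f.
  by rewrite subrr scaler0.
rewrite -scalerDr addrA subrK normrZ gtr0_norm ?invr_gt0// mulrC ler_pdivrMr//.
move=> zv; have := hd _ (Kz' (psi n)) (hN _ (Kz _)); apply/negP; rewrite -ltNge.
apply: le_lt_trans zv _.
have : r * (e / a) <= (1 + a) * (e / a) by rewrite ler_wpM2r ?divr_ge0 ?ltW.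
by rewrite /s /B /kap in ek k30 *; nra.
Qed.

End GeneralizedNonexpansive.

Theorem theorem4p5 (R : realType) (X : completeNormedModType R) (C : set X)
    (C_neq0 : C !=set0) (C_convex : convex_set C)
    (C_wcompact : weakly_compact C) (M_gt1 : (1 < param_M X)%E) :
  (forall T : X -> X, set_fun C C T -> condC C T ->
     exists2 x, C x & T x = x) /\
  (forall T : X -> X, set_fun C C T -> {within C, continuous T} ->
     forall lambda : R, 0 < lambda -> lambda < 1 -> condC_ lambda C T ->
     exists2 x, C x & T x = x).
Proof.
have Ccl := weakly_compact_closed C_wcompact.
have main T l : 0 < l -> l < 1 -> set_fun C C T -> condC_ l C T ->
    (forall K, K `<=` C -> set_fun K K T -> condC_ l K T ->
       (forall x, K x -> T x != x) -> afp_stable K T) ->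
    exists2 x, C x & T x = x.
  move=> l0 l1 CT TC Tstab.
  have [|K [KC KT Kmin]] := @minimal_invariant_body _ _ _ T C_wcompact.
    by split.
  have KTC : condC_ l K T by move=> x y /KC Cx /KC Cy; exact: TC.
  have [_ _ _ KTK] := KT.
  have [x Kx Tx] := minimal_fixed_point l0 l1 C_wcompact M_gt1 KC KT Kmin KTC
    (Tstab K KC KTK KTC).
  by exists x => //; exact: KC.
split=> [T CT TC|T CT Tc l l0 l1 TC].
  by apply: (main T 2^-1) => //; [lra|move=> K _ KT KTC _; exact: condC_afp_stable].
by apply: (main T l) => // K KC _ KTC nfix; exact: continuous_afp_stable Tc KTC nfix.
Qed.
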